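(* Let $G$ be an arbitrary connected graph, let $0<p<\frac{1}{2}$ be a noise parameter and let $0<\delta<\frac{1}{2}$ be a confidence threshold. Suppose the target is drawn from a probability distribution $\mu$ on the vertices of $G$ that is given to the algorithm as input. There exists an adaptive Las Vegas graph searching algorithm (in the noisy graph search model described in the context) that, after an expected number of at most $$\frac{1}{I(p)}\left(H(\mu)+\log_2 \delta^{-1}+1\right)$$ queries, returns the target correctly with probability at least $1-\delta$.
   Context: Noisy graph search model: $G=(V,E)$ is an undirected, unweighted connected graph and $v^*\in V$ is an unknown target. In each step the algorithm queries a vertex $q$. A correct answer is ''yes'' if $q=v^*$, and otherwise is a neighbor $u$ of $q$ lying on a shortest path from $q$ to $v^*$. Each answer, independently, is erroneous with probability $p$ (in which case it may be an arbitrary different answer); otherwise it is correct. The algorithm is adaptive, and in the Las Vegas setting the number of queries is a random variable whose expectation is bounded (expectation over the target distribution and the noise). $H(\mu)=\sum_x \mu(x)\log_2\frac{1}{\mu(x)}$ is the entropy of $\mu$, $H(p)=-p\log_2 p-(1-p)\log_2(1-p)$ and $I(p)=1-H(p)$. *)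

(* Defs.v *)
From HB Require Import structures.
From mathcomp Require Import all_boot all_order all_algebra.
From mathcomp Require Import all_classical all_reals all_analysis.
Set Implicit Arguments. Unset Strict Implicit. Unset Printing Implicit Defensive.
Import Order.TTheory GRing.Theory Num.Theory.
Local Open Scope ring_scope.

Section NoisyGraphSearch.
Variable R : realType.

Definition log2 (x : R) : R := ln x / ln 2.

Definition entropy (T : finType) (mu : T -> R) : R :=
  \sum_(x : T) (if mu x == 0 then 0 else mu x * log2 (mu x)^-1).

Definition Hbin (p : R) : R := - p * log2 p - (1 - p) * log2 (1 - p).
Definition Icap (p : R) : R := 1 - Hbin p.

Definition is_distr (T : finType) (mu : T -> R) : Prop :=
  (forall x, 0 <= mu x) /\ \sum_(x : T) mu x = 1.

Variable V : finType.
Variable e : rel V.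

Definition simple_graph : Prop := symmetric e /\ irreflexive e.
Definition connected_graph : Prop := forall x y, connect e x y.

Fixpoint nwalk (n : nat) (x y : V) : bool :=
  if n is n'.+1 then [exists z, e x z && nwalk n' z y] else x == y.

(** graph distance: least n with a walk of length n (for a connected graph
    such an n < #|V| always exists) *)
Definition gdist (x y : V) : nat := find (fun n => nwalk n x y) (iota 0 #|V|).

(** Answers: [None] = "yes", [Some u] = the neighbour u. *)
Definition answer := option V.

Definition correct_ans (t q : V) (a : answer) : bool :=
  if q == t then a == None
  else if a is Some u then e q u && ((gdist u t).+1 == gdist q t) else false.

Definition valid_ans (q : V) (a : answer) : bool :=
  if a is Some u then e q u else true.

(** Full (responder-side) history: (query, answer, error flag). *)
Definition rhist := seq (V * answer * bool).
(** What the algorithm sees: queries and answers. *)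
Definition ahist (h : rhist) : seq (V * answer) := [seq x.1 | x <- h].

(** A (possibly randomized) adaptive algorithm: given the history of queries and
    answers, a probability distribution on actions; [inl v] = stop and return v,
    [inr q] = query vertex q. *)
Definition algorithm := seq (V * answer) -> V + V -> R.
Definition algorithm_ok (A : algorithm) : Prop :=
  forall h, is_distr (A h).

(** A responder (adversary) chooses the answer given the target, the full
    history, the query and whether this answer is erroneous. *)
Definition responder := V -> rhist -> V -> bool -> answer.
Definition responder_ok (Rs : responder) : Prop :=
  forall t h q,
    correct_ans t q (Rs t h q false) /\
    valid_ans q (Rs t h q true) /\ ~~ correct_ans t q (Rs t h q true).

Variable p : R.

(** pstop n A Rs t h g : expectation of g (output, number of further queries)
    over the runs started from history h (target t) that stop after at most n
    further queries; each answer is erroneous independently with probability p. *)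
Fixpoint pstop (n : nat) (A : algorithm) (Rs : responder) (t : V) (h : rhist)
    (g : V -> nat -> R) : R :=
  \sum_(a : V + V) A (ahist h) a *
    match a with
    | inl v => g v 0%N
    | inr q =>
        if n is n'.+1 then
          (1 - p) * pstop n' A Rs t (rcons h (q, Rs t h q false, false))
                      (fun v k => g v k.+1)
          + p * pstop n' A Rs t (rcons h (q, Rs t h q true, true))
                      (fun v k => g v k.+1)
        else 0
    end.

Definition avg (mu : V -> R) (n : nat) (A : algorithm) (Rs : responder)
    (g : V -> V -> nat -> R) : R :=
  \sum_(t : V) mu t * pstop n A Rs t [::] (g t).

End NoisyGraphSearch.

(* Main.v *)
(* The algorithm keeps unnormalized weights: the weight of [v] starts at [mu v]
   and is multiplied by [2 (1 - p)] when an answer is compatible with [v] and by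
   [2 p] otherwise.  It stops at [v] as soon as the weight of [v] reaches
   [1 / delta], and otherwise queries a weighted median.  For the target [t],
   the logarithm of its weight has drift exactly [Icap p] per query and never
   exceeds [log2 (2 / delta)], since one query at most doubles a weight; this
   bounds the expected number of queries.  Against every responder, the total
   weight of the vertices other than [t] is a nonnegative supermartingale started
   below 1, so the probability that one of them ever reaches [1 / delta] is at
   most [delta].  Not normalizing is essential: when several answers are correct,
   the normalized weights are not posterior probabilities. *)
Require Import Defs.
From HB Require Import structures.
From mathcomp Require Import all_boot all_order all_algebra.
From mathcomp Require Import all_classical all_reals all_analysis.
From mathcomp Require Import ring lra.
Set Implicit Arguments.
Unset Strict Implicit.
Unset Printing Implicit Defensive.
Import Order.TTheory GRing.Theory Num.Theory.
Local Open Scope ring_scope.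

(** * Base-2 logarithms and the drift [Icap] *)

Section Log2.
Context {R : realType}.
Implicit Types x y p : R.

Lemma ln2_gt0 : 0 < ln 2 :> R.
Proof. by rewrite ln_gt0 // ltr1n. Qed.

Lemma log2M x y : 0 < x -> 0 < y -> log2 (x * y) = log2 x + log2 y.
Proof. by move=> x0 y0; rewrite /log2 lnM ?posrE // mulrDl. Qed.

Lemma log2V x : 0 < x -> log2 x^-1 = - log2 x.
Proof. by move=> x0; rewrite /log2 lnV ?posrE // mulNr. Qed.

Lemma log2_2 : log2 2 = 1 :> R.
Proof. by rewrite /log2 divff // gt_eqF // ln2_gt0. Qed.

Lemma ler_log2 x y : 0 < x -> x <= y -> log2 x <= log2 y.
Proof.
move=> x0 xy; rewrite /log2 ler_wpM2r ?invr_ge0 ?(ltW ln2_gt0) //.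
by rewrite ler_ln ?posrE // (lt_le_trans x0).
Qed.

(** The right-hand side is the mean growth, in one query, of the logarithm of the target's
    weight. *)
Lemma Icap_drift p : 0 < p -> p < 1 ->
  Icap p = (1 - p) * log2 (2 * (1 - p)) + p * log2 (2 * p).
Proof.
move=> p0 p1; rewrite !log2M ?subr_gt0 // log2_2 /Icap /Hbin; ring.
Qed.

Lemma ln_lt_subr1 x : 0 < x -> x != 1 -> ln x < x - 1.
Proof.
move=> x0 x1; have /expR_gt1Dx : ln x != 0 by rewrite ln_eq0.
by rewrite lnK ?posrE // ltrBrDl.
Qed.

Lemma Icap_gt0 p : 0 < p -> p < 1 / 2 -> 0 < Icap p.
Proof.
move=> p0 p2; have q0 : 0 < 1 - p by lra.
rewrite Icap_drift //; last by lra.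
(* This is [ln y < y - 1] at [y = 1 / (2 x)]; the lower bounds obtained for [p] and [1 - p] sum to
   zero. *)
have gibbs x : 0 < x -> 2 * x != 1 -> x - 1 / 2 < x * ln (2 * x).
  move=> x0 x1; have x20 : 0 < 2 * x by lra.
  have : ln (2 * x)^-1 < (2 * x)^-1 - 1.
    by apply: ln_lt_subr1; rewrite ?invr_gt0 // invr_eq1.
  rewrite lnV ?posrE // -(ltr_pM2l x0) => lt.
  have E : x * ((2 * x)^-1 - 1) = 1 / 2 - x by field; lra.
  by move: lt; rewrite E; lra.
have gp : p - 1 / 2 < p * ln (2 * p) by apply: gibbs => //; lra.
have gq : 1 - p - 1 / 2 < (1 - p) * ln (2 * (1 - p)) by apply: gibbs => //; lra.
by rewrite /log2 !mulrA -mulrDl divr_gt0 ?ln2_gt0 //; lra.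
Qed.

End Log2.

(** * Graph distance along an edge *)

Section Distances.
Variables (V : finType) (e : rel V).

Lemma gdist_nwalk x y : (gdist e x y < #|V|)%N -> nwalk e (gdist e x y) x y.
Proof.
move=> lt; have := @nth_find _ 0%N (fun n => nwalk e n x y) (iota 0 #|V|).
by rewrite has_find size_iota nth_iota //; apply.
Qed.

Lemma gdist_le_card x y : (gdist e x y <= #|V|)%N.
Proof. by rewrite -[X in (_ <= X)%N](size_iota 0) find_size. Qed.

Lemma nwalk_gdist_le n x y : nwalk e n x y -> (gdist e x y <= n)%N.
Proof.
move=> wn; case: (leqP (gdist e x y) n) => // lt.
have ltV := leq_trans lt (gdist_le_card x y).
have := @before_find _ 0%N (fun n => nwalk e n x y) _ _ lt.
by rewrite nth_iota // add0n wn.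
Qed.

Lemma gdist_edge_le u q v : e u q -> (gdist e u v <= (gdist e q v).+1)%N.
Proof.
move=> euq; case: (ltnP (gdist e q v) #|V|) => [lt|ge].
  by apply: nwalk_gdist_le; apply/existsP; exists q; apply/andP; split=> //; exact: gdist_nwalk.
(* Here [gdist e q v] has the default value [#|V|], which bounds every distance. *)
exact: leq_trans (gdist_le_card u v) (leqW ge).
Qed.

End Distances.

(** * Weighted medians *)

Section Median.
Variables (R : realType) (V : finType) (e : rel V).
Implicit Types (w : V -> R) (q u v t : V).

Definition total_dist w q : R := \sum_v w v * (gdist e q v)%:R.

Definition is_median w q := forall u, total_dist w q <= total_dist w u.

Lemma exists_median w : V -> exists q, is_median w q.
Proof.
move=> v0; exists [arg min_(q < v0) total_dist w q]%O => u.
by case: Order.TotalTheory.arg_minP => // i _; apply.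
Qed.

(** Moving from [q] to [u] brings each compatible vertex one step closer and any other at most one
    step farther. The total distance cannot drop, so the compatible weight is at most the remaining
    weight. *)
Lemma median_compatible_half w q u : symmetric e -> (forall v, 0 <= w v) ->
  is_median w q -> e q u ->
  2 * (\sum_(v | correct_ans e v q (Some u)) w v) <= \sum_v w v.
Proof.
move=> sym w0 med equ; rewrite -subr_ge0.
apply: (@le_trans _ _ (total_dist w u - total_dist w q)); first by rewrite subr_ge0 med.
rewrite /total_dist -sumrB [X in 2 * X]big_mkcond mulr_sumr -sumrB.
apply: ler_sum => v _; rewrite -mulrBr.
have le := gdist_edge_le v (etrans (sym u q) equ).
case: ifP => [|_]; last first.
  rewrite mulr0 subr0 -[X in _ <= X]mulr1 ler_wpM2l // lerBlDr.
  by rewrite nat1r ler_nat.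
rewrite /correct_ans; case: eqP => // _ /andP[_ /eqP <-].
by rewrite -natr1; have := w0 v; lra.
Qed.

End Median.

(** * Expectations over stopped runs *)

Section Runs.
Variables (R : realType) (V : finType) (e : rel V) (p : R).
Variables (A : algorithm R V) (Rs : responder V) (t : V).

Lemma pstopD n h (f g : V -> nat -> R) :
  pstop p n A Rs t h (fun v k => f v k + g v k) =
  pstop p n A Rs t h f + pstop p n A Rs t h g.
Proof.
elim: n h f g => [|n IH] h f g /=; rewrite -big_split /=; apply: eq_bigr => -[v|q] _.
- by rewrite mulrDr.
- by rewrite mulr0 addr0.
- by rewrite mulrDr.
- rewrite !IH; ring.
Qed.

Lemma pstop_ge0 n h (g : V -> nat -> R) : algorithm_ok A -> 0 <= p <= 1 ->
  (forall v k, 0 <= g v k) -> 0 <= pstop p n A Rs t h g.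
Proof.
move=> Aok /andP[p0 p1]; elim: n h g => [|n IH] h g g0 /=;
  apply: sumr_ge0 => -[v|q] _; rewrite mulr_ge0 ?(proj1 (Aok _)) //.
by rewrite addr_ge0 // mulr_ge0 ?IH // subr_ge0.
Qed.

Lemma pstop1_le1 n h : algorithm_ok A -> 0 <= p <= 1 ->
  pstop p n A Rs t h (fun _ _ => 1) <= 1.
Proof.
move=> Aok /andP[p0 p1]; elim: n h => [|n IH] h /=;
  rewrite -[X in _ <= X](proj2 (Aok (ahist h)));
  apply: ler_sum => -[v|q] _; rewrite -[X in _ <= X]mulr1 ler_wpM2l ?(proj1 (Aok _)) //.
rewrite [X in _ <= X](_ : 1 = (1 - p) * 1 + p * 1); last by ring.
by rewrite lerD // ler_wpM2l ?subr_ge0.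
Qed.

End Runs.

(** * Deterministic strategies *)

Section Deterministic.
Variables (R : realType) (V : finType).
Variable next : seq (V * answer V) -> V + V.

Definition deterministic : algorithm R V := fun h a => (a == next h)%:R.

Lemma sum_deterministic h (F : V + V -> R) :
  \sum_a deterministic h a * F a = F (next h).
Proof.
rewrite (bigD1 (next h)) //= /deterministic eqxx mul1r big1 ?addr0 // => a /negbTE ->.
by rewrite mul0r.
Qed.

Lemma deterministic_ok : algorithm_ok deterministic.
Proof.
move=> h; split=> [a|]; first exact: ler0n.
by under eq_bigr do rewrite -[deterministic _ _]mulr1; rewrite sum_deterministic.
Qed.

Variables (p : R) (Rs : responder V) (t : V).
Let E n h := pstop p n deterministic Rs t h.

Lemma pstop_inl n h g v : next (ahist h) = inl v -> E n h g = g v 0%N.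
Proof. by move=> N; case: n => [|n]; rewrite /E /= sum_deterministic N. Qed.

Lemma pstop_inr0 h g q : next (ahist h) = inr q -> E 0 h g = 0.
Proof. by move=> N; rewrite /E /= sum_deterministic N. Qed.

Lemma pstop_inrS n h g q : next (ahist h) = inr q ->
  E n.+1 h g =
    (1 - p) * E n (rcons h (q, Rs t h q false, false)) (fun v k => g v k.+1)
    + p * E n (rcons h (q, Rs t h q true, true)) (fun v k => g v k.+1).
Proof. by move=> N; rewrite /E /= sum_deterministic N. Qed.

End Deterministic.

(** * Weights, stopping rule, and the two martingale bounds *)

Section Weights.
Variables (R : realType) (V : finType) (e : rel V) (p delta : R) (mu : V -> R).
Hypotheses (p_gt0 : 0 < p) (p_lt : p < 1 / 2) (delta_gt0 : 0 < delta).
Hypothesis mu_ge0 : forall v, 0 <= mu v.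
Implicit Types (w : V -> R) (t q v : V) (a : answer V).

Definition factor v q a : R := if correct_ans e v q a then 2 * (1 - p) else 2 * p.

Definition weight (h : seq (V * answer V)) v : R :=
  mu v * \prod_(x <- h) factor v x.1 x.2.

Lemma factor_gt0 v q a : 0 < factor v q a.
Proof. have [p0 p2] := (p_gt0, p_lt); rewrite /factor; case: ifP => _; lra. Qed.

Lemma factor_le2 v q a : factor v q a <= 2.
Proof. have [p0 p2] := (p_gt0, p_lt); rewrite /factor; case: ifP => _; lra. Qed.

Lemma weight_rcons h q a v : weight (rcons h (q, a)) v = weight h v * factor v q a.
Proof. by rewrite /weight -cats1 big_cat big_seq1 mulrA. Qed.

Lemma weight_ge0 h v : 0 <= weight h v.
Proof. by rewrite mulr_ge0 // prodr_ge0 // => x _; rewrite ltW // factor_gt0. Qed.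

Lemma weight_gt0 h v : 0 < mu v -> 0 < weight h v.
Proof. by move=> mv; rewrite mulr_gt0 // prodr_gt0 // => x _; rewrite factor_gt0. Qed.

(** Every factor is [2 p], plus [2 (1 - 2 p)] on compatible vertices. *)
Lemma sum_factor w t q a :
  \sum_(v | v != t) w v * factor v q a =
  2 * p * (\sum_(v | v != t) w v)
  + 2 * (1 - 2 * p) * (\sum_(v | (v != t) && correct_ans e v q a) w v).
Proof.
rewrite [X in _ + _ * X]big_mkcondr !mulr_sumr -big_split /=.
by apply: eq_bigr => v _; rewrite /factor; case: ifP => _; ring.
Qed.

Lemma sum_compatible w t q a :
  \sum_(v | correct_ans e v q a) w v =
  (if correct_ans e t q a then w t else 0)
  + \sum_(v | (v != t) && correct_ans e v q a) w v.
Proof. by rewrite big_mkcond (bigD1 t) //= -big_mkcondr. Qed.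

(* If [q <> t] and the erroneous answer is "yes", it only favours [q], which the
   correct answer penalizes; the two other cases only use that an answer other
   than "yes" is compatible with at most half of the weight. *)
Lemma rivals_supermartingale w t q a b : symmetric e -> (forall v, 0 <= w v) ->
  is_median e w q -> correct_ans e t q a ->
  valid_ans e q b -> ~~ correct_ans e t q b ->
  (1 - p) * (\sum_(v | v != t) w v * factor v q a)
  + p * (\sum_(v | v != t) w v * factor v q b) <= \sum_(v | v != t) w v.
Proof.
move=> sym w0 med ca vb /negbTE cb; rewrite !sum_factor; have [p0 p2] := (p_gt0, p_lt).
set S := \sum_(v | v != t) w v.
set Ca := \sum_(v | _ && correct_ans e v q a) w v.
set Cb := \sum_(v | _ && correct_ans e v q b) w v.
(* By [sum_factor] the left-hand side is then at most [2 p S + (1 - 2 p) S = S]. *)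
suff half : (1 - p) * Ca + p * Cb <= S / 2.
  have : 0 <= (1 - 2 * p) * (S / 2 - ((1 - p) * Ca + p * Cb)) by rewrite mulr_ge0 //; lra.
  by lra.
have subS a' : \sum_(v | (v != t) && correct_ans e v q a') w v <= S.
  by rewrite big_mkcondr; apply: ler_sum => v _; case: ifP.
have total : \sum_v w v = w t + S by rewrite (bigD1 t).
have halfE u : e q u -> 2 * ((if correct_ans e t q (Some u) then w t else 0)
    + \sum_(v | (v != t) && correct_ans e v q (Some u)) w v) <= w t + S.
  by move=> equ; rewrite -sum_compatible -total; exact: median_compatible_half.
have wt0 := w0 t.
case: (eqVneq q t) => [qt|qt].
  have -> : Ca = 0.
    rewrite /Ca big_pred0 // => v; apply/negP => /andP[vt].
    move: ca; rewrite /correct_ans qt eqxx => /eqP -> /=.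
    by rewrite eq_sym (negbTE vt).
  have S0 : 0 <= S by apply: sumr_ge0.
  have := ler_wpM2l (ltW p_gt0) (subS b); rewrite -/Cb.
  have : 0 <= (1 / 2 - p) * S by rewrite mulr_ge0 //; lra.
  by lra.
case: a @Ca ca => [u|] Ca ca; last by move: ca; rewrite /correct_ans (negbTE qt).
have equ : e q u by move: ca; rewrite /correct_ans (negbTE qt) => /andP[].
have := halfE u equ; rewrite ca -/Ca => leCa.
have leCa' : 0 <= (1 - 2 * p) * (S - w t - 2 * Ca) by rewrite mulr_ge0 //; lra.
case: b @Cb vb cb => [u'|] Cb vb cb.
  have := halfE u' vb; rewrite cb -/Cb => leCb.
  have : 0 <= p * (w t + S - 2 * Cb) by rewrite mulr_ge0 //; lra.
  have : 0 <= (1 - p) * (S - w t - 2 * Ca) by rewrite mulr_ge0 //; lra.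
  have : 0 <= (1 - 2 * p) * w t by rewrite mulr_ge0 //; lra.
  by lra.
(* The answer [None] is compatible with [q] alone and [Some u] never with [q], so the two sums run
   over disjoint sets. *)
have : Ca + Cb <= S.
  rewrite /Ca /Cb 2!big_mkcondr -big_split /=; apply: ler_sum => v _.
  rewrite /correct_ans; case: (eqVneq q v) => [_|_]; rewrite ?add0r ?addr0 //.
  by case: ifP => _.
rewrite -(ler_pM2l p_gt0) => le.
have : 0 <= (1 - 2 * p) * w t by rewrite mulr_ge0 //; lra.
by lra.
Qed.

(** A relation, so that ties may be broken arbitrarily. The strict bound in the query case keeps
    every weight below [2 / delta] after the next answer. *)
Definition threshold_action (h : seq (V * answer V)) (x : V + V) : Prop :=
  match x with
  | inl v => delta^-1 <= weight h v
  | inr q => (forall v, weight h v < delta^-1) /\ is_median e (weight h) q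
  end.

Lemma exists_threshold_strategy : V -> exists next, forall h, threshold_action h (next h).
Proof.
move=> v0; suff ex h : exists x, threshold_action h x.
  by have [next nextP] := boolp.choice ex; exists next.
case: (pickP (fun v => delta^-1 <= weight h v)) => [v le|none]; first by exists (inl v).
have [q med] := exists_median e (weight h) v0; exists (inr q); split=> // v.
by rewrite ltNge none.
Qed.

Variable next : seq (V * answer V) -> V + V.
Hypothesis nextP : forall h, threshold_action h (next h).
Variable Rs : responder V.
Hypothesis RsP : responder_ok e Rs.
Variable t : V.
Let A : algorithm R V := deterministic R next.

Lemma ahist_rcons (h : rhist V) x : ahist (rcons h x) = rcons (ahist h) x.1.
Proof. exact: map_rcons. Qed.

(* The left-hand side is the expectation of [min T n], where [T] is the number
   of further queries. *)
Lemma truncated_time_le n h : 0 < mu t -> weight (ahist h) t <= 2 / delta ->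
  pstop p n A Rs t h (fun _ k => k%:R)
    + n%:R * (1 - pstop p n A Rs t h (fun _ _ => 1))
  <= (log2 (2 / delta) - log2 (weight (ahist h) t)) / Icap p.
Proof.
move=> mt0; have [p0 p2] := (p_gt0, p_lt); have I0 := Icap_gt0 p_gt0 p_lt.
have I0' : Icap p != 0 by rewrite gt_eqF.
have bound_ge0 h' : weight (ahist h') t <= 2 / delta ->
    0 <= (log2 (2 / delta) - log2 (weight (ahist h') t)) / Icap p.
  move=> le; rewrite divr_ge0 ?(ltW I0) // subr_ge0 ler_log2 //.
  exact: weight_gt0.
elim: n h => [|n IH] h le; case N: (next (ahist h)) => [v|q].
- by rewrite !(pstop_inl _ _ _ _ _ N) subrr mulr0 addr0 bound_ge0.
- by rewrite !(pstop_inr0 _ _ _ _ N) mul0r addr0 bound_ge0.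
- by rewrite !(pstop_inl _ _ _ _ _ N) subrr mulr0 addr0 bound_ge0.
rewrite !(pstop_inrS _ _ _ _ _ N).
under boolp.eq_fun do under boolp.eq_fun do rewrite -natr1.
rewrite !pstopD.
have [ca [vb cb]] := RsP t h q.
have := nextP (ahist h); rewrite N => -[lt _].
have step x : weight (ahist (rcons h x)) t <= 2 / delta.
  rewrite ahist_rcons [x.1]surjective_pairing weight_rcons mulrC.
  apply: ler_pM; rewrite ?factor_le2 ?weight_ge0 ?(ltW (factor_gt0 _ _ _)) //.
  exact: ltW.
have w0 := weight_gt0 (ahist h) mt0.
have := IH _ (step (q, Rs t h q false, false)).
have := IH _ (step (q, Rs t h q true, true)).
rewrite !ahist_rcons !weight_rcons.
have pa : 0 < 2 * (1 - p) by lra.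
have pb : 0 < 2 * p by lra.
rewrite /factor ca (negbTE cb) (log2M w0 pa) (log2M w0 pb).
set L := log2 (2 / delta); set lw := log2 (weight _ _) => leb lea.
have p1 : 0 <= 1 - p by lra.
have := lerD (ler_wpM2l p1 lea) (ler_wpM2l (ltW p0) leb).
set T := (1 - p) * (_ / _) + _.
(* The two inductive bounds average to the current bound minus 1, which pays for the query just
   made. *)
have -> : T = (L - lw) / Icap p - 1.
  rewrite -(mulfV I0') -mulrBl /T !mulrA -mulrDl.
  by congr (_ / _); rewrite Icap_drift //; [ring | lra].
rewrite -natr1; set n' := n%:R; lra.
Qed.


(** A wrong output has weight at least [1 / delta], so the right-hand side is then at least 1;
    before stopping, its mean does not grow. *)
Lemma wrong_output_le n h : symmetric e ->
  pstop p n A Rs t h (fun v _ => (v != t)%:R)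
  <= delta * \sum_(v | v != t) weight (ahist h) v.
Proof.
move=> sym; have [p0 p2] := (p_gt0, p_lt).
have rivals_ge0 h' : 0 <= \sum_(v | v != t) weight (ahist h') v.
  by apply: sumr_ge0 => v _; exact: weight_ge0.
have stop_le h' v : next (ahist h') = inl v ->
    (v != t)%:R <= delta * \sum_(v | v != t) weight (ahist h') v.
  move=> N; have := nextP (ahist h'); rewrite N => le.
  case: (altP (v =P t)) => [_|vt]; first by rewrite mulr_ge0 // ltW.
  rewrite -(mulfV (lt0r_neq0 delta_gt0)) ler_wpM2l ?(ltW delta_gt0) //.
  apply: (le_trans le); rewrite (bigD1 v) //= lerDl.
  by apply: sumr_ge0 => *; exact: weight_ge0.
elim: n h => [|n IH] h; case N: (next (ahist h)) => [v|q].
- by rewrite (pstop_inl _ _ _ _ _ N) stop_le.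
- by rewrite (pstop_inr0 _ _ _ _ N) mulr_ge0 // ltW.
- by rewrite (pstop_inl _ _ _ _ _ N) stop_le.
rewrite (pstop_inrS _ _ _ _ _ N).
have [ca [vb cb]] := RsP t h q.
have := nextP (ahist h); rewrite N => -[_ med].
have p1 : 0 <= 1 - p by lra.
apply: le_trans (lerD (ler_wpM2l p1 (IH _)) (ler_wpM2l (ltW p_gt0) (IH _))) _.
rewrite !ahist_rcons /=.
have splitE a : \sum_(v | v != t) weight (rcons (ahist h) (q, a)) v =
    \sum_(v | v != t) weight (ahist h) v * factor v q a.
  by apply: eq_bigr => v _; rewrite weight_rcons.
rewrite !splitE.
rewrite mulrCA [X in _ + X]mulrCA -mulrDr ler_wpM2l ?(ltW delta_gt0) //.
apply: rivals_supermartingale => // v; exact: weight_ge0.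
Qed.

End Weights.

(** * Averaging over the target *)

Unset Implicit Arguments.

Theorem theorem2 (R : realType) (V : finType) (e : rel V)
    (p delta : R) (mu : V -> R) :
  simple_graph e -> connected_graph e ->
  0 < p -> p < 1 / 2 -> 0 < delta -> delta < 1 / 2 ->
  is_distr mu ->
  exists A : algorithm R V, algorithm_ok A /\
    forall Rs : responder V, responder_ok e Rs ->
      (* Las Vegas: the algorithm stops almost surely *)
      (forall eps : R, 0 < eps -> exists n : nat,
         1 - eps <= avg p mu n A Rs (fun _ _ _ => 1)) /\
      (* expected number of queries is at most (H(mu) + log2 (1/delta) + 1) / I(p) *)
      (forall n : nat,
         avg p mu n A Rs (fun _ _ k => k%:R)
           <= (entropy mu + log2 delta^-1 + 1) / Icap p) /\
      (* the returned vertex is the target with probability >= 1 - delta *)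
      (forall eps : R, 0 < eps -> exists n : nat,
         1 - delta - eps <= avg p mu n A Rs (fun t v _ => (v == t)%:R)).
Proof.
move=> [sym _] _ p0 p2 d0 d2 [mu0 mu1].
have [v0 _] : exists v0 : V, true.
  case: (pickP (@predT V)) => [v0 _|none]; first by exists v0.
  by move/eqP: mu1; rewrite big_pred0 // eq_sym oner_eq0.
have [next nextP] := @exists_threshold_strategy _ _ e p delta mu v0.
exists (deterministic R next); split; first exact: deterministic_ok.
move=> Rs RsP; have Aok := deterministic_ok R next.
have p01 : 0 <= p <= 1 by lra.
have I0 : 0 < Icap p by exact: Icap_gt0.
set A := deterministic R next; set B := _ / Icap p.
have time_le n : avg p mu n A Rs (fun _ _ k => k%:R)
    + n%:R * (1 - avg p mu n A Rs (fun _ _ _ => 1)) <= B.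
  (* [log2 (2 / delta)] supplies the summand 1, and the initial weights [mu t] average to the
     entropy. *)
  have -> : B = \sum_t mu t * ((log2 (2 / delta) - log2 (mu t)) / Icap p).
    rewrite /B /entropy mulrC; under [RHS]eq_bigr do rewrite mulrA mulrC.
    rewrite -mulr_sumr; congr (_ * _).
    under [RHS]eq_bigr do rewrite mulrBr.
    rewrite sumrB -mulr_suml mu1 mul1r log2M ?invr_gt0 // log2_2.
    rewrite -addrA addrC [log2 _ + 1]addrC; congr (_ + _).
    rewrite -sumrN; apply: eq_bigr => t _; case: eqVneq => [->|t0].
      by rewrite mul0r oppr0.
    by rewrite log2V ?mulrN // lt_neqAle eq_sym t0 mu0.
  rewrite /avg -[X in X - _]mu1 -sumrB mulr_sumr -big_split /=; apply: ler_sum => t _.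
  have [->|t0] := eqVneq (mu t) 0; first by rewrite !mul0r subrr mulr0 addr0.
  have mt0 : 0 < mu t by rewrite lt_neqAle eq_sym t0 mu0.
  have mt1 : mu t <= 1.
    by rewrite -mu1 (bigD1 t) //= lerDl sumr_ge0.
  have w0 : weight e p mu (ahist [::]) t = mu t by rewrite /weight big_nil mulr1.
  have w_le : weight e p mu (ahist [::]) t <= 2 / delta.
    by rewrite w0 (le_trans mt1) // ler_pdivlMr //; lra.
  have := @truncated_time_le _ _ e p delta mu p0 p2 mu0 next nextP Rs RsP t n _ mt0 w_le.
  by rewrite w0 -/A => /(ler_wpM2l (ltW mt0)); lra.
have avg1_le1 n : avg p mu n A Rs (fun _ _ _ => 1) <= 1.
  rewrite -[X in _ <= X]mu1; apply: ler_sum => t _.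
  by rewrite -[X in _ <= X]mulr1 ler_wpM2l // pstop1_le1.
have avgk_ge0 n : 0 <= avg p mu n A Rs (fun _ _ k => k%:R).
  by apply: sumr_ge0 => t _; rewrite mulr_ge0 // pstop_ge0.
(* Markov's inequality: [n] times the probability of more than [n] queries is at most [B], so any
   [n > B / eps] works. *)
have stops eps : 0 < eps -> exists n, 1 - eps <= avg p mu n A Rs (fun _ _ _ => 1).
  move=> eps0; exists (Num.truncn (B / eps)).+1.
  have := truncnS_gt (B / eps); set n := _.+1; rewrite ltr_pdivrMr // => lt_B.
  have n0 : 0 < n%:R :> R by rewrite ltr0n.
  rewrite lerBlDr -lerBlDl -(ler_pM2l n0).
  by have := time_le n; have := avgk_ge0 n; lra.
split=> [//|]; split=> [n|eps eps0].
  apply: le_trans (time_le n); rewrite lerDl mulr_ge0 // subr_ge0.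
  exact: avg1_le1.
have [n le_n] := stops eps eps0; exists n.
have split_avg : avg p mu n A Rs (fun _ _ _ => 1) =
    avg p mu n A Rs (fun t v _ => (v == t)%:R)
    + avg p mu n A Rs (fun t v _ => (v != t)%:R).
  rewrite /avg -big_split /=; apply: eq_bigr => t _; rewrite -mulrDr -pstopD.
  by congr (_ * pstop _ _ _ _ _ _ _); do 2 apply: boolp.funext => ?; case: eqP; rewrite ?addr0 ?add0r.
suff : avg p mu n A Rs (fun t v _ => (v != t)%:R) <= delta by lra.
rewrite -[X in _ <= X]mul1r -[X in _ <= X * _]mu1 mulr_suml; apply: ler_sum => t _.
rewrite ler_wpM2l //.
(* Initially the rivals of [t] weigh [1 - mu t], hence at most 1. *)
apply: (le_trans (@wrong_output_le _ _ e p delta mu p0 p2 d0 mu0 next nextP Rs RsP t n [::] sym)).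
rewrite -[X in _ <= X]mulr1 ler_wpM2l ?(ltW d0) // -[X in _ <= X]mu1 [X in _ <= X](bigD1 t) //=.
under eq_bigr do rewrite /weight big_nil mulr1.
by rewrite lerDr.
Qed.
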